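(* For $n\ge 2$ let $\mathfrak{B}_n(x)=\sum_{k=0}^n D_{n,k}x^k$, where $D_{n,k}=\frac{2}{n(n+1)^2}\binom{n+1}{k-1}\binom{n+1}{k}\binom{n+1}{k+1}$, and let $$\mu_n=\frac{\mathfrak{B}_n'(1)}{\mathfrak{B}_n(1)},\qquad \sigma_n^2=\frac{\mathfrak{B}_n''(1)}{\mathfrak{B}_n(1)}+\mu_n-\mu_n^2 .$$ Then the coefficients $D_{n,k}$ of $\mathfrak{B}_n(x)$ are asymptotically normal with mean $\mu_n$ and variance $\sigma_n^2$ both by a local limit theorem on $\mathbb{R}$ and by a central limit theorem, and, as $n\to\infty$, $$\mu_n\sim \frac{n}{2}\qquad\text{and}\qquad \sigma_n^2\sim\frac{n}{12}.$$
   Context: Convention: $\binom{m}{-1}=0$, so $D_{n,0}=0$. Let $f_n(x)=\sum_{k=0}^n a(n,k)x^k$ be real polynomials with nonnegative coefficients, and let $p(n,k)=a(n,k)/\sum_{j=0}^n a(n,j)$ (this is the probability $\mathrm{Prob}(X_n=k)$ of an associated random variable $X_n$ supported on $\{0,\dots,n\}$; so $p(n,k)=0$ for integers $k$ outside $\{0,\dots,n\}$). Let $\sigma_n\ge 0$ be the square root of $\sigma_n^2$. The coefficients $a(n,k)$ are asymptotically normal with mean $\mu_n$ and variance $\sigma_n^2$ by a central limit theorem if $$\lim_{n\to\infty}\sup_{x\in\mathbb{R}}\left|\sum_{k\le \mu_n+x\sigma_n}p(n,k)-\frac{1}{\sqrt{2\pi}}\int_{-\infty}^x e^{-t^2/2}\,dt\right|=0.$$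 They are asymptotically normal with mean $\mu_n$ and variance $\sigma_n^2$ by a local limit theorem on $\mathbb{R}$ if $$\lim_{n\to\infty}\sup_{x\in\mathbb{R}}\left|\sigma_n\,p(n,\lfloor \mu_n+x\sigma_n\rfloor)-\frac{1}{\sqrt{2\pi}}e^{-x^2/2}\right|=0.$$ Here these definitions are applied to $f_n=\mathfrak{B}_n$, $a(n,k)=D_{n,k}$. The notation $u_n\sim v_n$ means $u_n/v_n\to1$ as $n\to\infty$. *)

(* Defs.v *)
From HB Require Import structures.
From mathcomp Require Import all_boot all_order all_algebra.
From mathcomp Require Import all_classical all_reals all_analysis.
Set Implicit Arguments.
Unset Strict Implicit.
Unset Printing Implicit Defensive.
Import Order.TTheory GRing.Theory Num.Theory.
Import numFieldNormedType.Exports.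
Local Open Scope classical_set_scope.
Local Open Scope ring_scope.

Section AsymptoticNormality.
Context {R : realType}.
Implicit Types (a : nat -> nat -> R) (mu sigmasq : nat -> R).

(* The index is an integer because the local limit theorem evaluates p(n, .)
   at floors that may be negative. *)
Definition prob a (n : nat) (k : int) : R :=
  match k with
  | Posz j => if (j <= n)%N then a n j / \sum_(i < n.+1) a n i else 0
  | Negz _ => 0
  end.

Definition gauss_density (x : R) : R :=
  1 / Num.sqrt (2 * pi) * expR (- x ^+ 2 / 2).

Definition gauss_cdf (x : R) : R :=
  1 / Num.sqrt (2 * pi) *
  \int[lebesgue_measure]_(t in `]-oo, x]) expR (- t ^+ 2 / 2).

(* In the two definitions below the supremum over x is taken in the extended
   reals, since the supremum of an unbounded set of reals has a junk value.
   Indices outside {0, ..., n} contribute nothing to the sum. *)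
Definition asymp_normal_clt a mu sigmasq : Prop :=
  ereal_sup (range (fun x : R =>
    `| \sum_(k < n.+1 | k%:R <= mu n + x * Num.sqrt (sigmasq n)) prob a n k%:Z
       - gauss_cdf x |%:E)) @[n --> \oo] --> 0%E.

Definition asymp_normal_llt a mu sigmasq : Prop :=
  ereal_sup (range (fun x : R =>
    `| Num.sqrt (sigmasq n) *
         prob a n (Num.floor (mu n + x * Num.sqrt (sigmasq n)))
       - gauss_density x |%:E)) @[n --> \oo] --> 0%E.

Definition asymp_equiv (u v : nat -> R) : Prop :=
  u n / v n @[n --> \oo] --> (1 : R).

End AsymptoticNormality.

(* binom(m, k - 1), with the convention binom(m, -1) = 0. *)
Definition bin_pred (m k : nat) : nat := if k is j.+1 then 'C(m, j) else 0.

Section Coefficients.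
Variable R : realType.

(* D_coef, B_poly and everything derived from them are meant for n >= 2; the
   values at n < 2 are irrelevant to the limits. *)
Definition D_coef (n k : nat) : R :=
  2 / (n%:R * n.+1%:R ^+ 2) *
  (bin_pred n.+1 k)%:R * 'C(n.+1, k)%:R * 'C(n.+1, k.+1)%:R.

Definition B_poly (n : nat) : {poly R} := \poly_(k < n.+1) D_coef n k.

Definition B_mean (n : nat) : R := (B_poly n)^`().[1] / (B_poly n).[1].

Definition B_var (n : nat) : R :=
  (B_poly n)^`(2).[1] / (B_poly n).[1] + B_mean n - B_mean n ^+ 2.

End Coefficients.

(* Main.v *)
Require Import Defs.
From mathcomp Require Import all_boot all_order all_algebra.
From mathcomp Require Import all_classical all_reals all_analysis.
From mathcomp Require Import measurable_realfun.
From mathcomp Require Import ring lra zify.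
Set Implicit Arguments.
Unset Strict Implicit.
Unset Printing Implicit Defensive.
Import Order.TTheory GRing.Theory Num.Theory.
Import numFieldNormedType.Exports.
Local Open Scope classical_set_scope.
Local Open Scope ring_scope.

(** Put m = n + 1, h = m/2 and y = k - h. Up to a factor depending on n only,
    D_coef n k is the weight w(k) = C(m,k-1) C(m,k) C(m,k+1), which is symmetric
    under k -> m - k, so that the mean is exactly h. Everything else comes from
    the ratio of consecutive weights, which is a product of three factors
    (N - u)/(N + u), where u = y + 1/2 and N differs from h by at most 3/2
    ([binom3_rec_mid]).

    Variance. Summation by parts against the recurrence yields, for every
    function g, a linear relation between moments of y (a discrete Stein
    identity, [binom3_stein]). Taking for g a polynomial of degree 1, then 3,
    relates the second moment to the fourth and bounds the fourth by O(h^2); the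
    variance is therefore h/6 + O(1) ([cmoment2_approx]).

    Shape. As log ((N - u)/(N + u)) is about -2u/N, multiplying the ratios from
    the centre c outwards gives w(k)/w(c) ~ exp (-3 y^2/h). The inequality
    1 + x <= exp x, applied to each factor and to its inverse, makes this precise:
    w(k)/w(c) lies between exp (-3 y^2/(h - |y|)) and
    exp (-3 (y^2 - 1/4)/(h + |y| + 1)) ([binom3_lb], [binom3_ub]). The upper bound is
    Gaussian over the whole range since |y| <= h.

    Limit theorems. Let s be the standard deviation and consider the step function
    G_n(x) = p(n, floor (h + x s)) / p(n, c). Because s^2 ~ h/6, the bounds show
    that G_n tends to exp (-x^2/2) uniformly on bounded sets and is dominated by
    a fixed Gaussian. Dominated convergence then gives convergence in L^1. The
    integral of G_n is 1/(s p(n, c)), so that s p(n, c) tends to 1/sqrt (2 pi):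
    with the uniform convergence this is the local limit theorem
    ([profile_llt]). A partial sum of the probabilities is an integral of G_n over
    a half-line, up to the same normalisation, and integrals over half-lines
    converge uniformly by the L^1 convergence: this is the central limit theorem
    ([profile_clt]). *)

(** * The weights C(m,k-1) C(m,k) C(m,k+1) *)

Definition binom3 (m k : nat) : nat := bin_pred m k * 'C(m, k) * 'C(m, k.+1).

Lemma D_coefE (R : realType) n k :
  D_coef R n k = 2 / (n%:R * n.+1%:R ^+ 2) * (binom3 n.+1 k)%:R.
Proof. by rewrite /D_coef /binom3 !natrM !mulrA. Qed.

Lemma binom30 m : binom3 m 0 = 0%N. Proof. by rewrite /binom3 !mul0n. Qed.

Lemma binom3_small m k : (m <= k)%N -> binom3 m k = 0%N.
Proof. by move=> mk; rewrite /binom3 (@bin_small m k.+1) ?muln0. Qed.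

Lemma binom3_gt0 m k : (0 < k < m)%N -> (0 < binom3 m k)%N.
Proof.
by case: k => // k km; rewrite /binom3 /= !muln_gt0 !bin_gt0; lia.
Qed.

Lemma binom3_sym m k : (k <= m)%N -> binom3 m (m - k) = binom3 m k.
Proof.
case: k => [_|k km]; first by rewrite subn0 binom30 binom3_small.
rewrite /binom3 bin_sub//; case: (ltnP k.+1 m) => [k1m|mk].
  have -> : (m - k.+1 = (m - k.+2).+1)%N by lia.
  rewrite /= (bin_sub k1m) -[(m - k.+2).+2](_ : (m - k = _)%N); last by lia.
  by rewrite (bin_sub (ltnW km)) mulnC mulnA mulnAC mulnC mulnA.
have -> : k = m.-1 by lia.
rewrite prednK; last by lia.
by rewrite subnn /= mul0n (@bin_small m m.+1)// muln0.
Qed.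

(** Clearing factorials in C(m,k+2) / C(m,k-1), the only factors on which
    consecutive coefficients differ. *)
Lemma binom3_rec (R : realType) m k : (k <= m)%N ->
  k%:R * (k%:R + 1) * (k%:R + 2) * (binom3 m k.+1)%:R =
  (m%:R - k%:R + 1) * (m%:R - k%:R) * (m%:R - k%:R - 1) * (binom3 m k)%:R :> R.
Proof.
move=> km; case: k km => [|k] km; first by rewrite binom30 mulr0 !mul0r.
have binR j : (j <= m)%N ->
    (j%:R + 1) * ('C(m, j.+1))%:R = (m%:R - j%:R) * ('C(m, j))%:R :> R.
  by move=> jm; rewrite natr1 -natrB// -!natrM mul_bin_left.
rewrite /binom3 /= !natrM.
have e0 := binR _ (ltnW km); have e1 := binR _ km.
have [k2m|mk2] := leqP k.+2 m; last first.
  have mE : m = k.+1 by lia.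
  by rewrite mE subrr mulr0 !mul0r (@bin_small k.+1 k.+3)// !mulr0.
have e2 := binR _ k2m.
set a := ('C(m, k))%:R in e0 *; set b := ('C(m, k.+1))%:R in e0 e1 *.
set c := ('C(m, k.+2))%:R in e1 e2 *; set d := ('C(m, k.+3))%:R in e2 *.
have k1 : k.+1%:R = k%:R + 1 :> R by rewrite -natr1.
have k2 : k.+2%:R = k%:R + 2 :> R by rewrite -addn2 natrD.
rewrite k1 k2 in e1 e2 *; set x := k%:R in e0 e1 e2 *; set M := m%:R in e0 e1 e2 *.
transitivity (b * c * (x + 1) * (x + 1 + 1) * ((x + 2 + 1) * d)); first by ring.
rewrite e2.
transitivity (b * c * (x + 1) * (M - (x + 2)) * ((x + 1 + 1) * c)); first by ring.
rewrite e1.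
transitivity (b * c * (M - (x + 2)) * (M - (x + 1)) * ((x + 1) * b)); first by ring.
by rewrite e0; ring.
Qed.

(** * Moments and variance *)

(** Moments are taken about m/2 and left unnormalised: the total mass has no
    simple closed form. *)
Definition cmoment (R : realType) (m j : nat) : R :=
  \sum_(k < m) (binom3 m k)%:R * (k%:R - m%:R / 2) ^+ j.

Lemma cmoment_gt0 (R : realType) m : (1 < m)%N -> 0 < cmoment R m 0.
Proof.
move=> m1; rewrite /cmoment (bigD1 (Ordinal m1))//= expr0 mulr1.
rewrite ltr_pwDl ?ltr0n ?binom3_gt0//.
by apply: sumr_ge0 => k _; rewrite expr0 mulr1.
Qed.

Lemma cmoment_even_ge0 (R : realType) m j : 0 <= cmoment R m j.*2.
Proof.
by apply: sumr_ge0 => k _; rewrite mulr_ge0// -mul2n mulnC exprM sqr_ge0.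
Qed.

Lemma cmoment1 (R : realType) m : cmoment R m 1 = 0.
Proof.
pose F (k : nat) : R := (binom3 m k)%:R * (k%:R - m%:R / 2) ^+ 1.
have E : cmoment R m 1 = \sum_(k < m.+1) F k.
  by rewrite big_ord_recr /= /F (@binom3_small m m)// mul0r addr0.
suff : cmoment R m 1 = - cmoment R m 1 by lra.
rewrite [in RHS]E -sumrN (reindex_inj rev_ord_inj)/= E.
apply: eq_bigr => k _; rewrite subSS /F.
have km : (k <= m)%N by rewrite -ltnS.
by rewrite -[in LHS]binom3_sym// natrB// !expr1; field.
Qed.

(** Summation by parts against the recurrence: a discrete Stein identity. The
    boundary terms vanish because the weights do at 0 and at m. *)
Lemma binom3_stein (R : realType) m (g : R -> R) (h := m%:R / 2)
    (A := fun t => (h + t) ^+ 3 - (h + t)) :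
  \sum_(k < m) (binom3 m k)%:R *
    (A (k%:R - h) * g (k%:R - h) - A (h - k%:R) * g (k%:R - h + 1)) = 0.
Proof.
pose F (k : nat) : R := (binom3 m k)%:R * A (k%:R - h) * g (k%:R - h).
transitivity (- \sum_(0 <= k < m) (F k.+1 - F k)); last first.
  by rewrite telescope_sumr// /F (@binom3_small m m)// binom30 !mul0r subrr oppr0.
rewrite big_mkord -sumrN; apply: eq_bigr => k _.
have := @binom3_rec R _ _ (ltnW (ltn_ord k)); rewrite /F => rec.
have kE : k.+1%:R - h = k%:R - h + 1 by rewrite -natr1; ring.
have mE : m%:R = 2 * h by rewrite /h; field.
rewrite kE opprB mulrBr mulrA mulrA; congr (_ - _ * _).
rewrite /A; move: rec; rewrite mE => rec.
transitivity (k%:R * (k%:R + 1) * (k%:R + 2) * (binom3 m k.+1)%:R : R); last by ring.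
by rewrite rec; ring.
Qed.

(** The choice of g makes g(y) and g(y + 1) the values at y - 1/2 and y + 1/2 of
    an odd function, so that only even moments survive; likewise below. *)
Lemma cmoment_rel2 (R : realType) m (h := m%:R / 2) :
  cmoment R m 2 * (6 * h ^+ 2 - 3 * h - 2) + 2 * cmoment R m 4 =
  (h ^+ 3 - h) * cmoment R m 0.
Proof.
apply/eqP; rewrite -subr_eq0 -[X in _ == X](binom3_stein m (fun t => t - 1 / 2)).
apply/eqP; rewrite /cmoment mulr_suml !mulr_sumr -big_split/= -sumrB.
by apply: eq_bigr => k _; rewrite -/h; field.
Qed.

Lemma cmoment_rel4 (R : realType) m (h := m%:R / 2) :
  2 * cmoment R m 6 + (6 * h ^+ 2 - 9 * h - 1 / 2) * cmoment R m 4 +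
  (9 / 2 * h ^+ 2 - 3 / 2 - 3 * h ^+ 3 + 9 / 4 * h) * cmoment R m 2 =
  (h ^+ 3 - h) / 4 * cmoment R m 0.
Proof.
apply/eqP; rewrite -subr_eq0.
rewrite -[X in _ == X](binom3_stein m (fun t => (t - 1 / 2) ^+ 3)).
apply/eqP; rewrite /cmoment !mulr_sumr -!big_split/= -sumrB.
by apply: eq_bigr => k _; rewrite -/h; field.
Qed.

(** The first relation gives a crude bound h/2 on the variance V; fed into the
    second, it bounds the normalised fourth moment K by h^2; the first relation
    then determines V up to a bounded error. *)
Lemma cmoment2_approx (R : realType) m : (6 <= m)%N ->
  `|cmoment R m 2 / cmoment R m 0 - m%:R / 12| <= 1 / 2.
Proof.
move=> m6; have m0 : 0 < cmoment R m 0 by apply: cmoment_gt0; lia.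
have h3 : 3 <= m%:R / 2 :> R.
  by rewrite ler_pdivlMr// -natrM ler_nat.
have := cmoment_rel2 R m; have := cmoment_rel4 R m.
have := cmoment_even_ge0 R m 3; have := cmoment_even_ge0 R m 2.
have := cmoment_even_ge0 R m 1; rewrite /=.
have -> : m%:R / 12 = m%:R / 2 / 6 :> R by field.
set h := m%:R / 2 in h3 *.
set M0 := cmoment R m 0 in m0 *; set M2 := cmoment R m 2; set M4 := cmoment R m 4.
set M6 := cmoment R m 6 => M2_ge0 M4_ge0 M6_ge0 rel4 rel2.
set V := M2 / M0; set K := M4 / M0; set L := M6 / M0.
have V0 : 0 <= V by rewrite divr_ge0// ltW.
have K0 : 0 <= K by rewrite divr_ge0// ltW.
have L0 : 0 <= L by rewrite divr_ge0// ltW.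
have {}rel2 : V * (6 * h ^+ 2 - 3 * h - 2) + 2 * K = h ^+ 3 - h.
  apply: (mulIf (lt0r_neq0 m0)); rewrite -rel2 /V /K; field.
  exact: lt0r_neq0.
have {}rel4 : 2 * L + (6 * h ^+ 2 - 9 * h - 1 / 2) * K +
  (9 / 2 * h ^+ 2 - 3 / 2 - 3 * h ^+ 3 + 9 / 4 * h) * V = (h ^+ 3 - h) / 4.
  apply: (mulIf (lt0r_neq0 m0)); rewrite -rel4 /V /K /L; field.
  exact: lt0r_neq0.
have h2 : 3 * h <= h ^+ 2 by nra.
have V1 : V <= h / 2.
  rewrite -subr_ge0 -(@pmulr_rge0 _ (6 * h ^+ 2 - 3 * h - 2)); last by nra.
  by nra.
have K1 : K <= h ^+ 2.
  have a0 : 0 < 6 * h ^+ 2 - 9 * h - 1 / 2 by nra.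
  rewrite -subr_ge0 -(@pmulr_rge0 _ (6 * h ^+ 2 - 9 * h - 1 / 2))//.
  have h30 : 0 <= h ^+ 3 by apply: exprn_ge0; lra.
  have : 3 * h ^+ 3 * V <= 3 / 2 * h ^+ 4.
    have : h ^+ 3 * V <= h ^+ 3 * (h / 2) by apply: ler_wpM2l.
    by rewrite (exprSr h 3); lra.
  have : 0 <= (9 / 2 * h ^+ 2 - 3 / 2 + 9 / 4 * h) * V by apply: mulr_ge0 => //; nra.
  have : 3 * h ^+ 3 <= h ^+ 4 by rewrite (exprSr h 3); nra.
  by nra.
have hp : 0 < 6 * h ^+ 2 by nra.
have e : 6 * h ^+ 2 * (V - h / 6) = 3 * (h * V) + 2 * V - h - 2 * K.
  have -> : 6 * h ^+ 2 * (V - h / 6) = 6 * h ^+ 2 * V - h ^+ 3 by field.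
  by lra.
have Vh : h * V <= h ^+ 2 / 2 by nra.
have hV : 0 <= h * V by nra.
by rewrite ler_norml -(ler_pM2l hp) -[X in _ && X](ler_pM2l hp) e; lra.
Qed.

(** * Gaussian bounds on the weights *)

(** The recurrence around the midpoint of k and k+1, at distance u from the
    centre h of symmetry: the ratio of consecutive weights is a product of three
    factors (N - u)/(N + u), with N = h + 3/2, h + 1/2, h - 1/2. *)
Lemma binom3_rec_mid (R : realType) m k (h := m%:R / 2 : R)
    (u := k%:R - h + 1 / 2) : (k <= m)%N ->
  (h + 3 / 2 + u) * (h + 1 / 2 + u) * (h - 1 / 2 + u) * (binom3 m k.+1)%:R =
  (h + 3 / 2 - u) * (h + 1 / 2 - u) * (h - 1 / 2 - u) * (binom3 m k)%:R.
Proof.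
move=> km; have := @binom3_rec R _ _ km.
have -> : m%:R = 2 * h :> R by rewrite /h; field.
rewrite /u => rec.
transitivity (k%:R * (k%:R + 1) * (k%:R + 2) * (binom3 m k.+1)%:R : R); first by field.
by rewrite rec; field.
Qed.

(** With x = - 2u/(N + u) in 1 + x <= exp x; the next lemma inverts the ratio and
    takes x = 2u/(N - u). *)
Lemma factor_le_expR (R : realType) (N u T : R) : 0 <= u -> 0 < N + u ->
  N + u <= T -> N - u <= (N + u) * expR (- (2 * u / T)).
Proof.
move=> u0 Nu0 NT; have T0 : 0 < T by exact: lt_le_trans NT.
apply: le_trans (_ : (N + u) * (1 + - (2 * u / T)) <= _); last first.
  by rewrite ler_pM2l// expR_ge1Dx.
rewrite mulrDr mulr1 mulrN lerBrDr -lerBrDl.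
have -> : N + u - (N - u) = 2 * u by ring.
by rewrite mulrCA ler_piMr ?mulr_ge0// ler_pdivrMr// mul1r.
Qed.

Lemma factor_ge_expR (R : realType) (N u T : R) : 0 <= u -> 0 < T ->
  T <= N - u -> (N + u) * expR (- (2 * u / T)) <= N - u.
Proof.
move=> u0 T0 TN; rewrite expRN ler_pdivrMr ?expR_gt0//.
apply: le_trans (_ : (N - u) * (1 + 2 * u / T) <= _); last first.
  by rewrite ler_pM2l ?expR_ge1Dx//; exact: lt_le_trans TN.
rewrite mulrDr mulr1 -lerBlDl.
have -> : N + u - (N - u) = 2 * u by ring.
by rewrite mulrCA ler_peMr ?mulr_ge0// ler_pdivlMr// mul1r.
Qed.

Lemma expR_third (R : realType) (u T : R) :
  expR (- (6 * u / T)) = expR (- (2 * u / T)) ^+ 3.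
Proof. by rewrite -expRM_natl; congr expR; ring. Qed.

Lemma binom3_ratio_ub (R : realType) m k (T : R) : (0 < k < m)%N ->
  (m <= k.*2.+1)%N -> k%:R + 2 <= T ->
  (binom3 m k.+1)%:R <= (binom3 m k)%:R * expR (- (6 * (k%:R - m%:R / 2 + 1 / 2) / T)).
Proof.
move=> /andP[k0 km] mk kT.
have k0R : 1 <= k%:R :> R by rewrite ler1n.
have kmR : k%:R + 1 <= m%:R :> R by rewrite natr1 ler_nat.
have mkR : m%:R <= 2 * k%:R + 1 :> R by rewrite -natrM natr1 ler_nat mul2n.
have := @binom3_rec_mid R m k (ltnW km).
set h := m%:R / 2; set u := k%:R - h + 1 / 2 => rec.
have u0 : 0 <= u by rewrite /u /h; lra.
have [p1 p2 p3] : [/\ 0 < h + 3 / 2 + u, 0 < h + 1 / 2 + u & 0 < h - 1 / 2 + u].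
  by rewrite /u; split; lra.
have [q2 q3] : 0 <= h + 1 / 2 - u /\ 0 <= h - 1 / 2 - u.
  by rewrite /u /h; split; lra.
rewrite -(ler_pM2l (mulr_gt0 (mulr_gt0 p1 p2) p3)) rec mulrA [leRHS]mulrAC.
apply: ler_wpM2r => //; rewrite expR_third.
have f N : 0 < N + u -> N + u <= T -> N - u <= (N + u) * expR (- (2 * u / T)).
  exact: factor_le_expR.
have := f _ p1; have := f _ p2; have := f _ p3.
set e := expR _ => f3 f2 f1.
have -> : (h + 3 / 2 + u) * (h + 1 / 2 + u) * (h - 1 / 2 + u) * e ^+ 3 =
  (h + 3 / 2 + u) * e * ((h + 1 / 2 + u) * e) * ((h - 1 / 2 + u) * e) by ring.
have q1 : 0 <= h + 3 / 2 - u by lra.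
apply: ler_pM; [exact: mulr_ge0|by []| |by apply: f3; rewrite /u; lra].
by apply: ler_pM; [by []|by []|apply: f1|apply: f2]; rewrite /u; lra.
Qed.

Lemma binom3_ratio_lb (R : realType) m k (T : R) : (0 < k)%N -> (k.+1 < m)%N ->
  (m <= k.*2.+1)%N -> 0 < T -> T <= m%:R - k%:R - 1 ->
  (binom3 m k)%:R * expR (- (6 * (k%:R - m%:R / 2 + 1 / 2) / T)) <= (binom3 m k.+1)%:R.
Proof.
move=> k0 km mk T0 Tk.
have k0R : 1 <= k%:R :> R by rewrite ler1n.
have mkR : m%:R <= 2 * k%:R + 1 :> R by rewrite -natrM natr1 ler_nat mul2n.
have := @binom3_rec_mid R m k (ltnW (ltnW km)).
set h := m%:R / 2; set u := k%:R - h + 1 / 2 => rec.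
have u0 : 0 <= u by rewrite /u /h; lra.
have [p1 p2 p3] : [/\ 0 < h + 3 / 2 + u, 0 < h + 1 / 2 + u & 0 < h - 1 / 2 + u].
  by rewrite /u; split; lra.
have Tu : T <= h - 1 / 2 - u by rewrite /u /h; lra.
rewrite -(ler_pM2l (mulr_gt0 (mulr_gt0 p1 p2) p3)) rec mulrA [leLHS]mulrAC.
apply: ler_wpM2r => //; rewrite expR_third.
have f N : T <= N - u -> (N + u) * expR (- (2 * u / T)) <= N - u.
  exact: factor_ge_expR.
have := f (h + 3 / 2); have := f (h + 1 / 2); have := f (h - 1 / 2).
have : 0 <= expR (- (2 * u / T)) by exact: expR_ge0.
set e := expR _ => e0 f3 f2 f1.
have -> : (h + 3 / 2 + u) * (h + 1 / 2 + u) * (h - 1 / 2 + u) * e ^+ 3 =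
  (h + 3 / 2 + u) * e * ((h + 1 / 2 + u) * e) * ((h - 1 / 2 + u) * e) by ring.
have [t1 t2 t3] : [/\ 0 <= (h + 3 / 2 + u) * e, 0 <= (h + 1 / 2 + u) * e
    & 0 <= (h - 1 / 2 + u) * e] by split; apply: mulr_ge0 => //; exact: ltW.
apply: ler_pM; [exact: mulr_ge0|by []| |exact: f3].
by apply: ler_pM; [by []|by []|apply: f1; lra|apply: f2; lra].
Qed.

Lemma half_dist (R : realType) m :
  0 <= (m%:R / 2 - (m./2)%:R : R) <= 1 / 2.
Proof.
have := odd_double_half m; set c := m./2; move=> <-.
rewrite natrD -muln2 natrM.
by case: (odd m) => /=; apply/andP; split; lra.
Qed.

(** Multiplying ratios from the centre outwards sums the midpoints u to half of
    y^2, up to the square of the offset (0 or 1/2) of the starting point. The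
    denominator T is kept fixed along the induction: it has to dominate the
    largest N + u met on the way. *)
Lemma binom3_right_ub (R : realType) m k (T : R) : (1 < m)%N ->
  (m./2 <= k)%N -> k%:R + 1 <= T ->
  (binom3 m k)%:R <=
  (binom3 m m./2)%:R * expR (- (3 * ((k%:R - m%:R / 2) ^+ 2 - 1 / 4) / T)).
Proof.
move=> m1; have /andP[c0 c1] := half_dist R m.
elim: k => [|k IH]; first by have : (0 < m./2)%N; [lia|case: m./2].
rewrite leq_eqVlt => /predU1P[<- cT|ck kT].
  have T0 : 0 < T by apply: lt_le_trans cT; rewrite ltr_pwDr.
  apply: ler_peMr => //; rewrite leNgt expR_lt1 -leNgt oppr_ge0 pmulr_lle0 ?invr_gt0//.
  by nra.
have [mk|km] := leqP m k.
  by rewrite binom3_small ?(leqW mk)// mulr_ge0// expR_ge0.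
have ckR : (m./2)%:R <= k%:R :> R by rewrite ler_nat.
rewrite -natr1 in kT.
have k0 : 0 <= k%:R :> R by [].
apply: le_trans (binom3_ratio_ub (T := T) _ _ _) _; [lia|lia|lra|].
apply: le_trans (_ : _ * expR (- (3 * ((k%:R - m%:R / 2) ^+ 2 - 1 / 4) / T)) * _ <= _).
  by apply: ler_wpM2r; [exact: expR_ge0|apply: IH; [lia|lra]].
rewrite -mulrA -expRD -natr1 le_eqVlt; apply/orP; left; apply/eqP.
by congr (_ * expR _); field; lra.
Qed.

Lemma binom3_right_lb (R : realType) m k (T : R) : (1 < m)%N ->
  (m./2 <= k < m)%N -> 0 < T -> T <= m%:R - k%:R ->
  (binom3 m m./2)%:R * expR (- (3 * (k%:R - m%:R / 2) ^+ 2 / T)) <= (binom3 m k)%:R.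
Proof.
move=> m1 ckm T0; have /andP[c0 c1] := half_dist R m.
elim: k ckm => [|k IH]; first by have : (0 < m./2)%N; [lia|case: m./2].
rewrite leq_eqVlt => /andP[/predU1P[<- _ _|ck km kT]].
  apply: ler_piMr => //; rewrite leNgt expR_gt1 -leNgt oppr_le0.
  by apply: divr_ge0; [apply: mulr_ge0 => //; exact: sqr_ge0|exact: ltW].
have ckR : (m./2)%:R <= k%:R :> R by rewrite ler_nat.
rewrite -natr1 in kT.
apply: le_trans _ (binom3_ratio_lb (T := T) _ _ _ _ _); [|lia|lia|lia|lra|lra].
apply: le_trans (_ : _ * expR (- (3 * (k%:R - m%:R / 2) ^+ 2 / T)) * _ <= _); last first.
  by apply: ler_wpM2r; [exact: expR_ge0|apply: IH; [lia|lra]].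
rewrite -[leRHS]mulrA -expRD -natr1 le_eqVlt; apply/orP; left; apply/eqP.
by congr (_ * expR _); field; lra.
Qed.

(** The left half reduces to the right one by symmetry. *)
Lemma binom3_ub (R : realType) m k (y := k%:R - m%:R / 2 : R) : (1 < m)%N ->
  (k <= m)%N -> (binom3 m k)%:R <=
  (binom3 m m./2)%:R * expR (- (3 * (y ^+ 2 - 1 / 4) / (m%:R / 2 + `|y| + 1))).
Proof.
move=> m1 km; have [ck|kc] := leqP m./2 k.
  apply: binom3_right_ub => //.
  by have := ler_norm y; rewrite /y; lra.
rewrite -binom3_sym//.
have -> : y ^+ 2 = ((m - k)%:R - m%:R / 2) ^+ 2.
  by rewrite natrB// /y; field.
apply: binom3_right_ub => //; first by lia.
by have := ler_norm (- y); rewrite normrN natrB// /y; lra.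
Qed.

Lemma binom3_lb (R : realType) m k (y := k%:R - m%:R / 2 : R) : (1 < m)%N ->
  `|y| < m%:R / 2 ->
  (binom3 m m./2)%:R * expR (- (3 * y ^+ 2 / (m%:R / 2 - `|y|))) <= (binom3 m k)%:R.
Proof.
move=> m1 ym; move: (ym); rewrite ltr_norml => /andP[ym1 ym2].
have km : (k < m)%N by rewrite -(ltr_nat R); move: ym2; rewrite /y; lra.
have k0 : (0 < k)%N by rewrite -(ltr_nat R); move: ym1; rewrite /y; lra.
have [ck|kc] := leqP m./2 k.
  apply: binom3_right_lb => //; [by rewrite ck|by lra|].
  by have := ler_norm y; rewrite /y; lra.
rewrite -(binom3_sym (ltnW km)).
have -> : y ^+ 2 = ((m - k)%:R - m%:R / 2) ^+ 2.
  by rewrite natrB 1?ltnW// /y; field.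
apply: binom3_right_lb => //; [by apply/andP; split; lia|by lra|].
by have := ler_norm (- y); rewrite normrN natrB 1?ltnW// /y; lra.
Qed.

(** * Step functions attached to a lattice distribution *)

Lemma sup_cvg0 (R : realType) (u : nat -> R -> R) :
  (forall e, 0 < e -> \forall n \near \oo, forall x, `|u n x| <= e) ->
  ereal_sup (range (fun x => `|u n x|%:E)) @[n --> \oo] --> 0%E.
Proof.
move=> H.
have sup0 n : (0 <= ereal_sup (range (fun x => `|u n x|%:E)))%E.
  by apply: le_ereal_sup_tmp; exists `|u n 0|%:E; [exists 0|rewrite lee_fin].
have supe n e : (forall x, `|u n x| <= e) ->
    (ereal_sup (range (fun x => `|u n x|%:E)) <= e%:E)%E.
  by move=> ue; apply: ge_ereal_sup => _ [x _ <-]; rewrite lee_fin.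
have fin n e : (forall x, `|u n x| <= e) ->
    ereal_sup (range (fun x => `|u n x|%:E)) \is a fin_num.
  by move=> /supe ue; rewrite ge0_fin_numE// (le_lt_trans ue)// ltry.
apply/fine_cvgP; split.
  by have := H 1 ltr01; apply: filterS => n; exact: fin.
apply/cvgrPdist_le => e e0; have := H e e0; apply: filterS => n Hn.
rewrite sub0r normrN ger0_norm ?fine_ge0//= -lee_fin fineK; first exact: supe.
exact: fin Hn.
Qed.

(** The points x at which mu + x s is rounded down to k. *)
Definition cell (R : realType) (mu s : R) (k : nat) : set R :=
  `[(k%:R - mu) / s, (k%:R + 1 - mu) / s[.

Lemma in_cell (R : realType) (mu s x : R) k : 0 < s ->
  (x \in cell mu s k) = (Num.floor (mu + x * s) == k%:Z).
Proof.
move=> s0; rewrite floor_eq /cell mem_setE in_itv/=.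
by rewrite ler_pdivrMr// ltr_pdivlMr// intrD lerBlDl ltrBrDl.
Qed.

Lemma prob_floorE (R : realType) (a : nat -> nat -> R) n (mu s x : R) : 0 < s ->
  prob a n (Num.floor (mu + x * s)) =
  \sum_(k < n.+1) prob a n k%:Z * \1_(cell mu s k) x.
Proof.
move=> s0; under eq_bigr do rewrite indicE in_cell//.
have : forall j, (n < j)%N -> prob a n j%:Z = 0 by move=> j nj /=; rewrite leqNgt nj.
have : forall j, prob a n (Negz j) = 0 by [].
case: (Num.floor _) => [j|j]; move: (prob a n) => p pN p0; last first.
  by rewrite pN big1// => i _; rewrite mulr0.
have [jn|nj] := ltnP j n.+1; last first.
  rewrite p0// big1// => i _; case: eqP => [[e]|]; last by rewrite mulr0.
  by have := ltn_ord i; rewrite -e ltnNge nj.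
rewrite (bigD1 (Ordinal jn))//= eqxx mulr1 big1 ?addr0// => i /eqP ij.
case: eqP => [[e]|]; last by rewrite mulr0.
by case: ij; apply: val_inj.
Qed.

Lemma lebesgue_cell (R : realType) (mu s : R) k : 0 < s ->
  lebesgue_measure (cell mu s k) = (s^-1)%:E.
Proof.
move=> s0; rewrite lebesgue_measure_itv/= lte_fin ltr_pM2r ?invr_gt0//.
rewrite ltrD2r ltrDl ltr01 -EFinB; congr (_%:E).
by field; exact: lt0r_neq0.
Qed.

Lemma integrable_cell (R : realType) (mu s c : R) k : 0 < s ->
  lebesgue_measure.-integrable setT (EFin \o (fun x => c * \1_(cell mu s k) x)).
Proof.
move=> s0.
have -> : EFin \o (fun x : R => c * \1_(cell mu s k) x) =
   (fun x => c%:E * (\1_(cell mu s k) x)%:E)%E by [].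
apply: integrableZl => //.
apply/integrableP; split.
  by apply/measurable_EFinP; apply: measurable_indic; exact: measurable_itv.
under eq_integral do rewrite /= ger0_norm//.
rewrite integral_indic//; last exact: measurable_itv.
by rewrite setIT; have := lebesgue_cell mu k s0 => /= ->; rewrite ltry.
Qed.

Lemma integrable_step (R : realType) (mu s : R) (c : nat -> R) N (P : pred nat) :
  0 < s -> lebesgue_measure.-integrable setT
    (EFin \o (fun x => \sum_(k < N | P k) c k * \1_(cell mu s k) x)).
Proof.
move=> s0.
have -> : EFin \o (fun x => \sum_(k < N | P k) c k * \1_(cell mu s k) x) =
    (fun x => \sum_(k < N | P k) (EFin \o (fun x => (c k * \1_(cell mu s k) x)%R)) x)%E.
  by apply/funext => x; rewrite /= sumEFin.
by apply: integrable_sum => // k _; exact: integrable_cell.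
Qed.

Lemma Rintegral_step (R : realType) (mu s : R) (c : nat -> R) N (P : pred nat) :
  0 < s ->
  \int[lebesgue_measure]_x (\sum_(k < N | P k) c k * \1_(cell mu s k) x) =
  (\sum_(k < N | P k) c k) / s.
Proof.
move=> s0; rewrite /Rintegral; under eq_integral do rewrite -sumEFin.
rewrite integral_sum//; last by move=> k; exact: integrable_cell.
under eq_bigr => k _.
  under eq_integral do rewrite EFinM.
  rewrite integralZl//; last first.
    have := integrable_cell mu 1 k s0.
    by under [in X in X -> _]eq_fun do rewrite /= mul1r.
  rewrite integral_indic//; last exact: measurable_itv.
  rewrite setIT; have := lebesgue_cell mu k s0 => /= ->.
  rewrite -EFinM; over.
by rewrite sumEFin/= mulr_suml.
Qed.

(** * Limit theorems from a Gaussian profile *)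

Lemma gauss_normal_pdf (R : realType) (C w x : R) : w != 0 ->
  C * expR (- x ^+ 2 / (2 * w ^+ 2)) = C / normal_peak w * normal_pdf 0 w x.
Proof.
move=> w0; rewrite normal_pdfE// /normal_fun subr0 mulr2n -mulrA.
rewrite mulKf ?gt_eqF ?normal_peak_gt0//; congr (_ * expR (_ / _)); ring.
Qed.

Lemma integrable_gauss (R : realType) (C w : R) : w != 0 ->
  lebesgue_measure.-integrable setT
    (EFin \o (fun x => C * expR (- x ^+ 2 / (2 * w ^+ 2)))).
Proof.
move=> w0.
have -> : EFin \o (fun x => C * expR (- x ^+ 2 / (2 * w ^+ 2))) =
    (fun x => (C / normal_peak w)%:E * (normal_pdf 0 w x)%:E)%E.
  by apply/funext => x /=; rewrite gauss_normal_pdf.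
by apply: integrableZl => //; exact: integrable_normal_pdf.
Qed.

Definition gauss_bell (R : realType) (x : R) : R := expR (- x ^+ 2 / 2).

Lemma gauss_bellE (R : realType) (x : R) :
  gauss_bell x = 1 * expR (- x ^+ 2 / (2 * 1 ^+ 2)).
Proof. by rewrite expr1n mulr1 mul1r. Qed.

Lemma integrable_gauss_bell (R : realType) :
  lebesgue_measure.-integrable setT (EFin \o @gauss_bell R).
Proof.
have -> : @gauss_bell R = (fun x => 1 * expR (- x ^+ 2 / (2 * 1 ^+ 2))).
  by apply/funext => x; exact: gauss_bellE.
by apply: integrable_gauss; exact: oner_neq0.
Qed.

Lemma Rintegral_gauss_bell (R : realType) :
  \int[lebesgue_measure]_x gauss_bell x = Num.sqrt (2 * pi) :> R.
Proof.
have o0 := oner_neq0 R.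
rewrite /Rintegral; under eq_integral do rewrite gauss_bellE gauss_normal_pdf// EFinM.
rewrite integralZl//; last exact: integrable_normal_pdf.
rewrite integral_normal_pdf mule1/= /normal_peak invrK mul1r expr1n mul1r.
by rewrite mulr_natl.
Qed.

Lemma gauss_bell_le1 (R : realType) (x : R) : gauss_bell x <= 1.
Proof.
by rewrite /gauss_bell -[leRHS]expR0 ler_expR mulNr oppr_le0 divr_ge0 ?sqr_ge0.
Qed.

(** From exp t >= 1 + t: beyond M one has x^2 >= |x| >= M. *)
Lemma gauss_tail (R : realType) (C w e : R) : w != 0 -> 0 <= C -> 0 < e ->
  exists M, forall x, M < `|x| -> C * expR (- x ^+ 2 / (2 * w ^+ 2)) <= e.
Proof.
move=> w0 C0 e0; have w2 : 0 < 2 * w ^+ 2 by rewrite mulr_gt0// exprn_even_gt0.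
exists (1 + 2 * w ^+ 2 * C / e) => x Mx.
have K0 : 0 <= 2 * w ^+ 2 * C / e 
  by apply: divr_ge0; [apply: mulr_ge0 => //|]; exact: ltW.
have x2 : 2 * w ^+ 2 * C / e <= x ^+ 2.
  by rewrite -real_normK ?num_real// expr2; nra.
have t0 : C / e <= x ^+ 2 / (2 * w ^+ 2).
  by rewrite ler_pdivlMr// mulrC mulrA.
rewrite mulNr expRN ler_pdivrMr ?expR_gt0//.
have := expR_ge1Dx (x ^+ 2 / (2 * w ^+ 2)) => E.
rewrite -ler_pdivrMl// mulrC; apply: le_trans t0 _; apply: le_trans E.
by rewrite lerDr.
Qed.

Lemma Rintegral_le_setT (R : realType) (f : R -> R) (B : set R) :
  measurable B -> (forall x, 0 <= f x) ->
  lebesgue_measure.-integrable setT (EFin \o f) ->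
  \int[lebesgue_measure]_(x in B) f x <= \int[lebesgue_measure]_x f x.
Proof.
move=> mB f0 intf; rewrite Rintegral_mkcond; apply: le_Rintegral => //.
  rewrite -restrict_EFin; apply/(integrable_mkcond _ _).1 => //.
  by refine (integrableS _ _ _ intf).
by move=> x _; rewrite patchE; case: ifP.
Qed.

(** The vertical scale T of the profile G is arbitrary, unlike the factor s that the
    local limit theorem prescribes: the hypotheses then do not involve the total
    mass, and T ~ sqrt (2 pi) s comes out as a conclusion ([profile_scale]). *)
Section gaussian_profile.
Context (R : realType) (a : nat -> nat -> R) (mu sigmasq T : nat -> R) (C w : R).
Let s n := Num.sqrt (sigmasq n).
Let G n (x : R) := T n * prob a n (Num.floor (mu n + x * s n)).

Hypothesis s_oo : s n @[n --> \oo] --> +oo.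
Hypothesis mass1 : \forall n \near \oo, \sum_(k < n.+1) prob a n k%:Z = 1.
Hypothesis w_neq0 : w != 0.
Hypothesis dominated : \forall n \near \oo, forall x : R,
  `|G n x| <= C * expR (- x ^+ 2 / (2 * w ^+ 2)).
Hypothesis locally_uniform : forall M e : R, 0 < e -> \forall n \near \oo,
  forall x : R, `|x| <= M -> `|G n x - gauss_bell x| <= e.

Let C_ge0 : 0 <= C.
Proof.
have [n Hn] := filter_ex dominated.
by rewrite -(pmulr_lge0 _ (expR_gt0 (- 0 ^+ 2 / (2 * w ^+ 2)))) (le_trans _ (Hn 0)).
Qed.

Let s_gt0 : \forall n \near \oo, 0 < s n.
Proof. by move/cvgryPgt : s_oo; apply. Qed.

Lemma profile_uniform e : 0 < e ->
  \forall n \near \oo, forall x, `|G n x - gauss_bell x| <= e.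
Proof.
move=> e0; have e20 : 0 < e / 2 by rewrite divr_gt0.
have [M1 M1P] := gauss_tail w_neq0 C_ge0 e20.
have [M2 M2P] := gauss_tail (oner_neq0 R) ler01 e20.
have := locally_uniform (Num.max M1 M2) e0; have := dominated.
apply: filterS2 => n dom loc x.
have [xM|] := leP `|x| (Num.max M1 M2); first exact: loc.
rewrite gt_max => /andP[/M1P x1 /M2P x2].
rewrite (splitr e); apply: le_trans (ler_normB _ _) _; apply: lerD.
  exact: le_trans (dom x) x1.
by rewrite ger0_norm ?expR_ge0// gauss_bellE.
Qed.

Let G_step n x : 0 < s n ->
  G n x = \sum_(k < n.+1) (T n * prob a n k%:Z) * \1_(cell (mu n) (s n) k) x.
Proof.
move=> sn; rewrite /G prob_floorE// mulr_sumr.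
by apply: eq_bigr => k _; rewrite mulrA.
Qed.

Let integrable_G n : 0 < s n ->
  lebesgue_measure.-integrable setT (EFin \o G n).
Proof.
move=> sn; have -> : G n = fun x =>
    \sum_(k < n.+1) (T n * prob a n k%:Z) * \1_(cell (mu n) (s n) k) x.
  by apply/funext => x; exact: G_step.
exact: (integrable_step _ (fun k => T n * prob a n k%:Z) _ xpredT).
Qed.

(** Dominated convergence, along the tail of the sequence from which on the
    domination holds. *)
Lemma profile_L1 :
  \int[lebesgue_measure]_x `|G n x - gauss_bell x| @[n --> \oo] --> 0.
Proof.
have [N _ HN] : \forall n \near \oo, 0 < s n /\ (forall x,
    `|G n x| <= C * expR (- x ^+ 2 / (2 * w ^+ 2))).
  by have := s_gt0; have := dominated; apply: filterS2 => n dn sn; split.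
rewrite -(cvg_shiftn N).
have HN' n : (N <= n + N)%N by rewrite leq_addl.
have [|||||_ + _] := @dominated_convergence _ _ R lebesgue_measure setT
    measurableT (fun n => EFin \o G (n + N)%N) (EFin \o @gauss_bell R)
    (EFin \o (fun x => C * expR (- x ^+ 2 / (2 * w ^+ 2)))).
- by move=> n; have [sn _] := HN _ (HN' n); case/integrableP : (integrable_G sn).
- by case/integrableP : (integrable_gauss_bell R).
- apply: aeW => x _; rewrite (cvg_shiftn N (fun n => (G n x)%:E)).
  apply: cvg_EFin; first by near=> n.
  apply/cvgrPdist_le => e e0; have := profile_uniform e0.
  by apply: filterS => n Gn /=; rewrite distrC.
- exact: integrable_gauss.
- by apply: aeW => x n _; rewrite /= lee_fin; apply: (HN _ (HN' n)).2.
by move=> /fine_cvg; apply.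
Unshelve. all: by end_near. Qed.

Let integrable_dist n : 0 < s n -> lebesgue_measure.-integrable setT
  (EFin \o (fun x => `|G n x - gauss_bell x|)).
Proof.
move=> sn.
have -> : EFin \o (fun x => `|G n x - gauss_bell x|) =
  abse \o ((EFin \o G n) \- (EFin \o @gauss_bell R))%E by [].
apply: integrable_abse; apply: integrableB => //; first exact: integrable_G.
exact: integrable_gauss_bell.
Qed.

Lemma profile_Rintegral n (B : set R) : measurable B -> 0 < s n ->
  `|\int[lebesgue_measure]_(x in B) G n x -
    \int[lebesgue_measure]_(x in B) gauss_bell x| <=
  \int[lebesgue_measure]_x `|G n x - gauss_bell x|.
Proof.
move=> mB sn.
have iG : lebesgue_measure.-integrable B (EFin \o G n).
  by apply: integrableS (integrable_G sn).
have ig : lebesgue_measure.-integrable B (EFin \o @gauss_bell R).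
  by apply: integrableS (integrable_gauss_bell R).
rewrite -RintegralB//; apply: le_trans.
  by apply: le_normr_Rintegral => //; exact: integrableB iG ig.
by apply: Rintegral_le_setT => //; exact (integrable_dist sn).
Qed.

(** Both sides are total integrals, of the profile and of its limit. *)
Lemma profile_scale : T n / s n @[n --> \oo] --> Num.sqrt (2 * pi).
Proof.
rewrite -Rintegral_gauss_bell.
apply/cvgrPdist_le => e e0.
have /cvgrPdist_le/(_ e e0) := profile_L1; have := s_gt0; have := mass1.
apply: filterS3 => n mn sn; rewrite sub0r normrN => Hn; rewrite distrC.
have -> : T n / s n = \int[lebesgue_measure]_x G n x.
  under eq_Rintegral do rewrite G_step//.
  rewrite (Rintegral_step _ (fun k => T n * prob a n k%:Z) _ xpredT)//.
  by rewrite -mulr_sumr mn mulr1.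
apply: le_trans (profile_Rintegral measurableT sn) _.
exact: le_trans (ler_norm _) Hn.
Qed.

Let inv_scale : s n / T n @[n --> \oo] --> 1 / Num.sqrt (2 * pi).
Proof.
have r0 : Num.sqrt (2 * pi) != 0 :> R by rewrite sqrtr_eq0 -ltNge mulr_gt0// pi_gt0.
by rewrite div1r; under eq_cvg do rewrite -invf_div; apply: cvgV r0 profile_scale.
Qed.

Let T_neq0 : \forall n \near \oo, T n != 0.
Proof.
have r0 : 0 < Num.sqrt (2 * pi) :> R by rewrite sqrtr_gt0 mulr_gt0// pi_gt0.
have /cvgrPdist_lt/(_ _ r0) := profile_scale; apply: filterS => n.
by apply: contraTneq => ->; rewrite mul0r subr0 gtr0_norm// ltxx.
Qed.

Lemma profile_llt : asymp_normal_llt a mu sigmasq.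
Proof.
set r := 1 / Num.sqrt (2 * pi) : R.
have r0 : 0 <= r by rewrite divr_ge0// sqrtr_ge0.
apply: sup_cvg0 => e e0.
have d0 : 0 < e / 2 / (r + 1) by rewrite divr_gt0 ?divr_gt0// ltr_wpDl.
have e2 : 0 < e / 2 by rewrite divr_gt0.
near=> n => x.
have Tn : T n != 0 by near: n.
have unif : `|G n x - gauss_bell x| <= e / 2 / (r + 1).
  by move: x; near: n; exact: profile_uniform.
have r1 : `|r - s n / T n| <= 1.
  by near: n; move/cvgrPdist_le : inv_scale; apply.
have sT : `|s n / T n| <= r + 1.
  rewrite -[s n / T n](subKr r) (le_trans (ler_normB _ _))//.
  by rewrite (ger0_norm r0) lerD2l.
have re : `|r - s n / T n| <= e / 2.
  by near: n; move/cvgrPdist_le : inv_scale; apply.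
have -> : gauss_density x = r * gauss_bell x by [].
have -> : Num.sqrt (sigmasq n) * prob a n (Num.floor (mu n + x * Num.sqrt (sigmasq n)))
    = s n / T n * G n x by rewrite /G mulrA divfK.
have -> : s n / T n * G n x - r * gauss_bell x =
  s n / T n * (G n x - gauss_bell x) + (s n / T n - r) * gauss_bell x by ring.
rewrite (splitr e) (le_trans (ler_normD _ _))// lerD// normrM.
  apply: le_trans (ler_pM _ _ sT unif) _ => //.
  by rewrite mulrC divfK// gt_eqF// ltr_wpDl.
rewrite distrC -[leRHS]mulr1 ler_pM// ger0_norm ?expR_ge0//.
exact: gauss_bell_le1.
Unshelve. all: by end_near. Qed.

(** Truncating at x would cut a cell in two; x' is the right end of the cell of x,
    at distance at most 1/s from x. *)
Let partial_sum n (x : R) (z := mu n + x * s n)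
    (x' := ((Num.floor z + 1)%:~R - mu n) / s n) : 0 < s n ->
  \int[lebesgue_measure]_(y in `]-oo, x'[) G n y =
  T n / s n * \sum_(k < n.+1 | k%:R <= z) prob a n k%:Z.
Proof.
move=> sn; rewrite Rintegral_mkcond.
rewrite (_ : G n \_ _ = fun y => \sum_(k < n.+1 | k%:R <= z)
    (T n * prob a n k%:Z) * \1_(cell (mu n) (s n) k) y); last first.
  apply/funext => y; rewrite patchE mem_setE in_itv/= G_step//.
  have -> : (y < x') = (Num.floor (mu n + y * s n) <= Num.floor z).
    by rewrite /x' ltr_pdivlMr// ltrBrDl -floor_lt_int ltzD1.
  rewrite [RHS]big_mkcond; case: ifPn => fz.
    apply: eq_bigr => k _; case: ifPn => [//|kz].
    rewrite indicE in_cell//; case: eqP => [fk|]; last by rewrite mulr0.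
    by case/negP: kz; move: fz; rewrite fk floor_ge_int.
  rewrite big1// => k _; case: ifPn => [kz|//].
  rewrite indicE in_cell//; case: eqP => [fk|]; last by rewrite mulr0.
  by case/negP: fz; rewrite fk floor_ge_int.
rewrite (Rintegral_step _ (fun k => T n * prob a n k%:Z) n.+1 (fun k => k%:R <= z))//.
by rewrite -mulr_sumr mulrAC.
Qed.

Lemma profile_clt : asymp_normal_clt a mu sigmasq.
Proof.
set r := 1 / Num.sqrt (2 * pi) : R.
set q := Num.sqrt (2 * pi) : R.
have q0 : 0 < q by rewrite sqrtr_gt0 mulr_gt0// pi_gt0.
have r0 : 0 <= r by rewrite divr_ge0// ltW.
apply: sup_cvg0 => e e0.
have d0 : 0 < e / 3 / (r + 1) by rewrite divr_gt0 ?divr_gt0// ltr_wpDl.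
have e3 : 0 < e / 3 / q by rewrite !divr_gt0.
near=> n => x.
have Tn : T n != 0 by near: n.
have sn : 0 < s n by near: n.
have L1 : \int[lebesgue_measure]_x `|G n x - gauss_bell x| <= e / 3 / (r + 1).
  apply: le_trans (ler_norm _) _; rewrite -normrN -sub0r.
  by near: n; move/cvgrPdist_le : profile_L1; apply.
have r1 : `|r - s n / T n| <= 1.
  by near: n; move/cvgrPdist_le : inv_scale; apply.
have sT : `|s n / T n| <= r + 1.
  rewrite -[s n / T n](subKr r) (le_trans (ler_normB _ _))//.
  by rewrite (ger0_norm r0) lerD2l.
have re : `|r - s n / T n| <= e / 3 / q.
  by near: n; move/cvgrPdist_le : inv_scale; apply.
have sn1 : (s n)^-1 <= e / 3 / (r + 1).
  rewrite invf_ple//; near: n; move/cvgryPge : s_oo; apply.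
set z := mu n + x * s n.
set S := \sum_(_ < _ | _) _.
have -> : gauss_cdf x = r * \int[lebesgue_measure]_(t in `]-oo, x]) gauss_bell t by [].
set D := \int[lebesgue_measure]_(t in `]-oo, x]) gauss_bell t.
pose x' := ((Num.floor z + 1)%:~R - mu n) / s n.
have D0 : 0 <= D by apply: Rintegral_ge0 => t _; exact: expR_ge0.
have Dq : D <= q.
  rewrite /q -Rintegral_gauss_bell; apply: Rintegral_le_setT => //.
    by move=> t; exact: expR_ge0.
  exact (integrable_gauss_bell R).
have xx' : x < x'.
  rewrite ltr_pdivlMr// ltrBrDl.
  by have /andP[] := floor_itv z.
have x'x : x' - x <= (s n)^-1.
  rewrite lerBlDr ler_pdivrMr// mulrDl mulVf ?gt_eqF// intrD lerBlDr.
  by rewrite addrC -addrA lerD2l addrC; exact: floor_le.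
have E : `|\int[lebesgue_measure]_(t in `]-oo, x'[) gauss_bell t - D| <= (s n)^-1.
  rewrite Rintegral_itvB ?bnd_simp//; last first.
    by apply: integrableS (integrable_gauss_bell R).
  rewrite ger0_norm; last by apply: Rintegral_ge0 => t _; exact: expR_ge0.
  apply: le_trans x'x.
  have -> : x' - x = \int[lebesgue_measure]_(t in `]x, x'[) (1 : R).
    rewrite Rintegral_cst// mul1r.
    have := @lebesgue_measure_itv R `]x, x'[ => /= ->.
    by rewrite lte_fin xx'.
  apply: le_Rintegral => //.
  - by apply: integrableS (integrable_gauss_bell R).
  - apply/integrableP; split; first exact: measurable_cst.
    under eq_integral do rewrite /= normr1.
    rewrite integral_cst// mul1e.
    have := @lebesgue_measure_itv R `]x, x'[ => /= ->.
    by rewrite lte_fin xx' -EFinB ltry.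
  - by move=> t _; exact: gauss_bell_le1.
have F := profile_Rintegral (measurable_itv `]-oo, x'[) sn.
rewrite partial_sum// -/z -/S in F.
(* the errors: L^1 distance and part of a cell for the first term, normalisation for
   the second *)
have -> : S - r * D = s n / T n * (T n / s n * S - D) + (s n / T n - r) * D.
  by field; rewrite Tn gt_eqF.
have TSD : `|T n / s n * S - D| <= 2 * (e / 3 / (r + 1)).
  rewrite mulr_natl mulr2n; apply: le_trans (ler_distD _ _ _) _.
  exact: lerD (le_trans F L1) (le_trans E sn1).
have -> : e = (r + 1) * (2 * (e / 3 / (r + 1))) + e / 3 / q * q.
  by field; rewrite !gt_eqF// ltr_wpDl.
apply: le_trans (ler_normD _ _) _; rewrite (normrM (s n / T n)) (normrM _ D).
apply: lerD.
  exact: ler_pM.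
by rewrite (ger0_norm D0) distrC; apply: ler_pM.
Unshelve. all: by end_near. Qed.

End gaussian_profile.

(** * Mean and variance of the coefficients *)

Lemma horner1_poly (R : realType) N (E : nat -> R) :
  (\poly_(k < N) E k).[1] = \sum_(k < N) E k.
Proof.
rewrite poly_def horner_sum; apply: eq_bigr => k _.
by rewrite hornerZ hornerXn expr1n mulr1.
Qed.

Lemma horner1_deriv (R : realType) N (E : nat -> R) :
  (\poly_(k < N) E k)^`().[1] = \sum_(k < N) E k * k%:R.
Proof.
rewrite poly_def raddf_sum horner_sum; apply: eq_bigr => k _.
by rewrite /= derivZ derivXn hornerZ hornerMn hornerXn expr1n.
Qed.

Lemma horner1_deriv2 (R : realType) N (E : nat -> R) :
  (\poly_(k < N) E k)^`(2).[1] = \sum_(k < N) E k * (k%:R * (k%:R - 1)).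
Proof.
rewrite derivSn derivn1 poly_def !raddf_sum horner_sum; apply: eq_bigr => k _.
have -> : k%:R * (k%:R - 1) = (k * k.-1)%:R :> R.
  case: (k : nat) => [|j]; first by rewrite mul0n mul0r.
  by rewrite natrM -[j.+1%:R - 1]/(_ - 1) -natr1 addrK.
rewrite /= !derivZ derivXn derivMn derivXn hornerZ !hornerMn hornerXn expr1n.
by rewrite -mulrnA mulnC.
Qed.

Lemma scale_gt0 (R : realType) n : (0 < n)%N ->
  0 < 2 / (n%:R * n.+1%:R ^+ 2) :> R.
Proof. by move=> n0; rewrite divr_gt0 ?mulr_gt0 ?exprn_gt0 ?ltr0n. Qed.

Lemma sum_D_coef (R : realType) n :
  \sum_(k < n.+1) D_coef R n k =
  2 / (n%:R * n.+1%:R ^+ 2) * cmoment R n.+1 0.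
Proof.
rewrite /cmoment mulr_sumr; apply: eq_bigr => k _.
by rewrite D_coefE expr0 mulr1.
Qed.

Lemma prob_D_coef (R : realType) n k : (0 < n)%N ->
  prob (D_coef R) n k%:Z = (binom3 n.+1 k)%:R / cmoment R n.+1 0.
Proof.
move=> n0; rewrite /prob; case: leqP => kn; last first.
  by rewrite binom3_small ?mul0r.
rewrite sum_D_coef D_coefE -mulf_div divff ?mul1r//.
by rewrite gt_eqF// scale_gt0.
Qed.

Lemma sum_prob_D_coef (R : realType) n : (0 < n)%N ->
  \sum_(k < n.+1) prob (D_coef R) n k%:Z = 1.
Proof.
move=> n0; under eq_bigr do rewrite prob_D_coef//.
rewrite -mulr_suml (_ : \sum_(i < _) _ = cmoment R n.+1 0) ?divff//.
  by rewrite gt_eqF// cmoment_gt0.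
by apply: eq_bigr => k _; rewrite expr0 mulr1.
Qed.

Lemma B_meanE (R : realType) n : (0 < n)%N -> B_mean R n = n.+1%:R / 2.
Proof.
move=> n0; rewrite /B_mean /B_poly horner1_deriv horner1_poly sum_D_coef.
have k0 := scale_gt0 R n0; have M0 : 0 < cmoment R n.+1 0 by exact: cmoment_gt0.
set K := 2 / _ in k0 *; set h := n.+1%:R / 2.
have -> : \sum_(k < n.+1) D_coef R n k * k%:R =
    K * (cmoment R n.+1 1 + h * cmoment R n.+1 0).
  rewrite /cmoment [h * _]mulr_sumr -big_split/= mulr_sumr; apply: eq_bigr => k _.
  by rewrite D_coefE -/K -/h; ring.
by rewrite cmoment1 add0r; field; rewrite !gt_eqF.
Qed.

Lemma B_varE (R : realType) n : (0 < n)%N ->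
  B_var R n = cmoment R n.+1 2 / cmoment R n.+1 0.
Proof.
move=> n0; rewrite /B_var B_meanE// /B_poly horner1_deriv2 horner1_poly sum_D_coef.
have k0 := scale_gt0 R n0; have M0 : 0 < cmoment R n.+1 0 by exact: cmoment_gt0.
set K := 2 / _ in k0 *; set h := n.+1%:R / 2.
have -> : \sum_(k < n.+1) D_coef R n k * (k%:R * (k%:R - 1)) =
    K * (cmoment R n.+1 2 + (2 * h - 1) * cmoment R n.+1 1 +
         (h ^+ 2 - h) * cmoment R n.+1 0).
  rewrite /cmoment [X in _ = K * (_ + X + _)]mulr_sumr.
  rewrite [X in _ = K * (_ + X)]mulr_sumr -!big_split/= mulr_sumr.
  apply: eq_bigr => k _.
  by rewrite D_coefE -/K -/h; ring.
by rewrite cmoment1 mulr0 addr0; field; rewrite !gt_eqF.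
Qed.

Lemma B_var_approx (R : realType) n : (5 <= n)%N ->
  `|B_var R n - n.+1%:R / 12| <= 1 / 2.
Proof. by move=> n5; rewrite B_varE ?cmoment2_approx//; lia. Qed.

Lemma asymp_equiv_bounded (R : realType) (u : nat -> R) (d C : R) : 0 < d ->
  (\forall n \near \oo, `|u n - n%:R / d| <= C) ->
  asymp_equiv u (fun n => n%:R / d).
Proof.
move=> d0 uC; apply/cvgrPdist_le => e e0; near=> n.
have n0 : 0 < n%:R :> R by rewrite ltr0n; near: n; exact: nbhs_infty_gt.
have nC : d * C / e <= n%:R by near: n; exact: nbhs_infty_ger.
have un : `|u n - n%:R / d| <= C by near: n.
have nd : 0 < n%:R / d by rewrite divr_gt0.
rewrite distrC -[X in _ - X](@divff _ (n%:R / d)) ?gt_eqF// -mulrBl normrM.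
rewrite normfV (gtr0_norm nd) ler_pdivrMr//; apply: le_trans un _.
by rewrite mulrA ler_pdivlMr// [C * d]mulrC [e * _]mulrC -ler_pdivrMr.
Unshelve. all: by end_near. Qed.

(** * Convergence of the profile of the coefficients *)

(** The reciprocal of the central probability; with this scaling the profile has
    height 1 at the centre, like the limit. *)
Definition peak_scale (R : realType) (n : nat) : R :=
  cmoment R n.+1 0 / (binom3 n.+1 n.+1./2)%:R.

Lemma peak_probE (R : realType) n k : (0 < n)%N ->
  peak_scale R n * prob (D_coef R) n k%:Z =
  (binom3 n.+1 k)%:R / (binom3 n.+1 n.+1./2)%:R.
Proof.
move=> n0; rewrite prob_D_coef// /peak_scale.
have M0 : cmoment R n.+1 0 != 0 by rewrite gt_eqF// cmoment_gt0.
have c0 : (binom3 n.+1 n.+1./2)%:R != 0 :> R.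
  by rewrite pnatr_eq0 -lt0n binom3_gt0//; lia.
by field; rewrite M0 c0.
Qed.

Lemma peak_prob_ge0 (R : realType) n K : (0 < n)%N ->
  0 <= peak_scale R n * prob (D_coef R) n K.
Proof.
by case: K => k n0; [rewrite peak_probE// divr_ge0|rewrite mulr0].
Qed.

Lemma peak_prob_out (R : realType) n K : (0 < n)%N ->
  n.+1%:R / 2 < `|K%:~R - n.+1%:R / 2 : R| ->
  peak_scale R n * prob (D_coef R) n K = 0.
Proof.
case: K => k n0; last by rewrite mulr0.
move=> kh; rewrite peak_probE// binom3_small ?mul0r//.
rewrite -(ler_nat R); move: kh; rewrite ltr_normr => /orP[]; first by lra.
by have : 0 <= k%:R :> R by []; lra.
Qed.

Lemma peak_prob_ub (R : realType) n K (y := K%:~R - n.+1%:R / 2 : R) :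
  (0 < n)%N -> peak_scale R n * prob (D_coef R) n K <=
  expR (- (3 * (y ^+ 2 - 1 / 4) / (n.+1%:R / 2 + `|y| + 1))).
Proof.
rewrite /y {y}; case: K => k n0; last by rewrite mulr0 expR_ge0.
rewrite peak_probE//; have [kn|nk] := leqP k n.+1; last first.
  by rewrite binom3_small ?(ltnW nk)// mul0r expR_ge0.
have c0 : 0 < (binom3 n.+1 n.+1./2)%:R :> R.
  by rewrite ltr0n binom3_gt0//; lia.
by rewrite ler_pdivrMr// mulrC; exact: binom3_ub.
Qed.

Lemma peak_prob_lb (R : realType) n K (y := K%:~R - n.+1%:R / 2 : R) :
  (0 < n)%N -> `|y| < n.+1%:R / 2 ->
  expR (- (3 * y ^+ 2 / (n.+1%:R / 2 - `|y|))) <=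
  peak_scale R n * prob (D_coef R) n K.
Proof.
rewrite /y {y}; case: K => k n0 yh; last first.
  move: yh; rewrite ltr_norml NegzE mulrNz => /andP[+ _].
  have : 0 <= k.+1%:R :> R by [].
  by rewrite -[k.+1%:~R]/(k.+1%:R); lra.
have c0 : 0 < (binom3 n.+1 n.+1./2)%:R :> R.
  by rewrite ltr0n binom3_gt0//; lia.
rewrite peak_probE// ler_pdivlMr// mulrC; exact: binom3_lb.
Qed.

Lemma gauss_bell_perturb (R : realType) (x eta G : R) : 0 <= eta <= 1 / 2 ->
  expR (- (x ^+ 2 / 2 + eta)) <= G <= expR (- (x ^+ 2 / 2 - eta)) ->
  `|G - gauss_bell x| <= 2 * eta.
Proof.
move=> /andP[eta0 eta1]; rewrite opprD opprB [eta - _]addrC !expRD -mulNr.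
rewrite -/(gauss_bell x); set g := gauss_bell x => /andP[lb ub].
have g0 : 0 <= g by exact: expR_ge0.
have g1 : g <= 1 by exact: gauss_bell_le1.
have E1 : 1 - eta <= expR (- eta) by exact: expR_ge1Dx.
have E2 : expR eta * expR (- eta) = 1 by rewrite -expRD subrr expR0.
have E3 : 0 <= expR eta by exact: expR_ge0.
have E4 : expR eta <= 1 + 2 * eta.
  have : expR eta * (1 - eta) <= 1 by rewrite -[leRHS]E2 ler_wpM2l.
  by nra.
by rewrite ler_distl; apply/andP; split; nra.
Qed.

(** Replacing y by x s costs at most 2 M s + 1 in y^2, replacing s^2 by h/6 at
    most x^2/2 in x^2 s^2, and replacing the denominators by h a relative error
    of order M s/h; the last hypothesis on theta makes all of these small. *)
Lemma exponent_bounds (R : realType) (h s x y M theta : R)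
    (eta := (M ^+ 2 / 2 + 7) * theta) :
  0 <= s -> `|s ^+ 2 - h / 6| <= 1 / 2 -> `|x| <= M -> `|y - x * s| <= 1 ->
  0 < theta -> M * s + 5 <= theta * (h - (M * s + 1)) ->
  [/\ `|y| < h, 3 * y ^+ 2 / (h - `|y|) <= x ^+ 2 / 2 + eta
    & x ^+ 2 / 2 - eta <= 3 * (y ^+ 2 - 1 / 4) / (h + `|y| + 1)].
Proof.
move=> s0 sh xM yxs th0; move EY : (M * s + 1) => Y Yh.
have M0 : 0 <= M by exact: le_trans xM.
have Ms0 : 0 <= M * s by exact: mulr_ge0.
have hY : 0 < h - Y by rewrite -(pmulr_rgt0 _ th0) (lt_le_trans _ Yh)//; lra.
have xsM : `|x * s| <= M * s by rewrite normrM (ger0_norm s0) ler_wpM2r.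
have yY : `|y| <= Y.
  rewrite -(subrK (x * s) y) (le_trans (ler_normD _ _))// addrC -EY.
  exact: lerD.
have yxs2 : `|y ^+ 2 - x ^+ 2 * s ^+ 2| <= 2 * (M * s) + 1.
  rewrite -exprMn subr_sqr normrM -[leRHS]mul1r; apply: ler_pM => //.
  rewrite (le_trans (ler_normD _ _))//.
  by move: yY xsM; lra.
have x2 : 0 <= x ^+ 2 <= M ^+ 2.
  by rewrite sqr_ge0 -real_normK ?num_real// lerXn2r.
have xh : `|x ^+ 2 * s ^+ 2 - x ^+ 2 * (h / 6)| <= x ^+ 2 / 2.
  rewrite -mulrBr normrM ger0_norm ?sqr_ge0//.
  by rewrite ler_wpM2l ?sqr_ge0// -[leRHS]div1r.
have y0 : 0 <= `|y| by [].
move: x2 xh yxs2; rewrite !ler_norml => /andP[x20 x2M] /andP[xh1 xh2] /andP[y1 y2].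
have h0 : 0 < h by lra.
have thh : theta * (h - Y) <= theta * h by rewrite ler_pM2l//; lra.
have key : x ^+ 2 * (Y + 4) <= M ^+ 2 * (theta * (h - Y)).
  by apply: ler_pM => //; lra.
have M2 : M ^+ 2 * (theta * (h - Y)) <= M ^+ 2 * (theta * h).
  by rewrite ler_wpM2l ?sqr_ge0.
have yh : `|y| < h by lra.
split=> //.
- apply: le_trans (_ : 3 * y ^+ 2 / (h - Y) <= _).
    apply: ler_wpM2l; first by apply: mulr_ge0 => //; exact: sqr_ge0.
    by rewrite lef_pV2 ?posrE; lra.
  rewrite ler_pdivrMr//.
  have -> : (x ^+ 2 / 2 + eta) * (h - Y) =
     x ^+ 2 * (h / 6) * 3 - x ^+ 2 * (Y + 4) / 2 + 2 * x ^+ 2 +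
     M ^+ 2 * (theta * (h - Y)) / 2 + 7 * (theta * (h - Y)).
    by rewrite /eta; field.
  by lra.
- rewrite ler_pdivlMr; last by lra.
  apply: le_trans (_ : x ^+ 2 / 2 * (h + Y + 1) - eta * h <= _).
    rewrite mulrBl lerB//.
      by rewrite ler_wpM2l ?divr_ge0//; lra.
    by rewrite ler_wpM2l /eta ?mulr_ge0//; nra.
  have -> : x ^+ 2 / 2 * (h + Y + 1) - eta * h =
    x ^+ 2 * (h / 6) * 3 + x ^+ 2 * (Y + 4) / 2 - 3 / 2 * x ^+ 2
    - M ^+ 2 * (theta * h) / 2 - 7 * (theta * h).
    by rewrite /eta; field.
  by lra.
Qed.

Lemma floor_dist (R : realType) (h t : R) :
  `|((Num.floor (h + t))%:~R - h) - t| <= 1.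
Proof.
have /andP[] := floor_itv (h + t); rewrite intrD => a b.
by rewrite ler_distl; apply/andP; split; lra.
Qed.

(** The width 4 and the constant exp 2 leave room for crude estimates: since
    h + |y| + 1 <= 2 h + 1 and s^2 >= h/12, the exponent in the upper bound is
    close to x^2/16 or larger. *)
Lemma peak_dominated (R : realType) n (x : R) : (11 <= n)%N ->
  `|peak_scale R n *
     prob (D_coef R) n (Num.floor (B_mean R n + x * Num.sqrt (B_var R n)))| <=
  expR 2 * expR (- x ^+ 2 / (2 * 4 ^+ 2)).
Proof.
move=> n11; have n0 : (0 < n)%N by lia.
have V := @B_var_approx R n (leq_trans _ n11).
rewrite B_meanE//; set h := n.+1%:R / 2; set s := Num.sqrt _.
have h6 : 6 <= h by rewrite /h ler_pdivlMr// -natrM ler_nat; lia.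
have V0 : h / 12 <= B_var R n.
  by move: (V isT); rewrite ler_distl => /andP[+ _]; rewrite /h in h6 *; lra.
have s2 : h / 12 <= s ^+ 2 by rewrite sqr_sqrtr//; lra.
have := floor_dist h (x * s); set K := Num.floor _; set y := K%:~R - h => yxs.
rewrite ger0_norm ?peak_prob_ge0//.
have [hy|yh] := ltP h `|y|.
  by rewrite peak_prob_out// mulr_ge0 ?expR_ge0.
apply: le_trans (peak_prob_ub _ _ n0) _; rewrite -/h -/y -expRD ler_expR.
rewrite mulNr lerNl opprB; have y0 : 0 <= `|y| by [].
rewrite ler_pdivlMr; last by lra.
have y2 : x ^+ 2 * s ^+ 2 <= 2 * y ^+ 2 + 2.
  have yxs2 : (y - x * s) ^+ 2 <= 1 by rewrite -real_normK ?num_real// expr_le1.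
  rewrite -exprMn; move: yxs2; set t := x * s => yxs2.
  by have := sqr_ge0 (2 * y - t); lra.
have X0 : 0 <= x ^+ 2 by exact: sqr_ge0.
have X1 : x ^+ 2 * h <= 24 * (y ^+ 2 + 1) by nra.
have X2 : x ^+ 2 * 6 <= x ^+ 2 * h by rewrite ler_wpM2l.
have X3 : x ^+ 2 * (h + `|y| + 1) <= x ^+ 2 * (2 * h + 1).
  by rewrite ler_wpM2l//; lra.
by have := sqr_ge0 y; nra.
Qed.

Lemma peak_locally_uniform (R : realType) (M e : R) : 0 < e ->
  \forall n \near \oo, forall x, `|x| <= M ->
  `|peak_scale R n *
     prob (D_coef R) n (Num.floor (B_mean R n + x * Num.sqrt (B_var R n)))
    - gauss_bell x| <= e.
Proof.
move=> e0; pose eta := Num.min (e / 2) (1 / 2).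
have eta0 : 0 < eta by rewrite lt_min !divr_gt0.
pose theta := eta / (M ^+ 2 / 2 + 7).
have M7 : 0 < M ^+ 2 / 2 + 7 by rewrite ltr_wpDl// divr_ge0 ?sqr_ge0.
have th0 : 0 < theta by rewrite divr_gt0.
(* K1 s + K2 <= h is the smallness condition of exponent_bounds solved for h;
   as s^2 <= h it follows from K1^2 + 2 K2 <= h. *)
pose K1 := M * (1 + theta) / theta; pose K2 := 5 / theta + 1.
near=> n => x xM.
have n5 : (5 <= n)%N by near: n; exists 5%N.
have n0 : (0 < n)%N by exact: leq_trans n5.
have := B_var_approx R n5; rewrite B_meanE//.
have := ler0n R n.+1.
have : 2 * (K1 ^+ 2 + 2 * K2) <= n.+1%:R.
  apply: le_trans (_ : n%:R <= _); last by rewrite ler_nat.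
  by near: n; exact: nbhs_infty_ger.
have -> : n.+1%:R / 12 = n.+1%:R / 2 / 6 :> R by field.
have h3 : 3 <= n.+1%:R / 2 :> R.
  by rewrite ler_pdivlMr// -natrM ler_nat.
move: h3; set h := n.+1%:R / 2; set s := Num.sqrt _ => h3 hK _ V.
have V0 : 0 <= B_var R n.
  by move: V; rewrite ler_distl => /andP[+ _]; lra.
have s0 : 0 <= s by exact: sqrtr_ge0.
have sh : `|s ^+ 2 - h / 6| <= 1 / 2 by rewrite sqr_sqrtr.
have s2 : s ^+ 2 <= h by move: sh; rewrite ler_distl => /andP[_]; lra.
have cond : M * s + 5 <= theta * (h - (M * s + 1)).
  have : K1 * s + K2 <= h.
    have hK' : K1 ^+ 2 + 2 * K2 <= h by rewrite /h; lra.
    by have := sqr_ge0 (K1 - s); nra.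
  rewrite -(ler_pM2l th0).
  have -> : theta * (K1 * s + K2) = M * (1 + theta) * s + 5 + theta.
    by rewrite /K1 /K2; field; exact: lt0r_neq0.
  by lra.
have := floor_dist h (x * s); set K := Num.floor _; set y := K%:~R - h => yxs.
have [yh ub lb] := exponent_bounds s0 sh xM yxs th0 cond.
have etaE : (M ^+ 2 / 2 + 7) * theta = eta.
  by rewrite /theta; field; apply: lt0r_neq0; lra.
rewrite etaE in ub lb.
have eta2 : 2 * eta <= e.
  by rewrite -ler_pdivlMl// mulrC ge_min lexx.
apply: le_trans eta2; apply: gauss_bell_perturb.
  by rewrite ltW//= ge_min lexx orbT.
apply/andP; split.
  by apply: le_trans (peak_prob_lb n0 yh); rewrite -/h -/y ler_expR lerN2.
by apply: le_trans (peak_prob_ub _ _ n0) _; rewrite -/h -/y ler_expR lerN2.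
Unshelve. all: by end_near. Qed.

Lemma sqrt_B_var_cvgy (R : realType) :
  Num.sqrt (B_var R n) @[n --> \oo] --> +oo.
Proof.
apply/cvgryPge => A; near=> n.
have n5 : (5 <= n)%N by near: n; exists 5%N.
have nA : 12 * (A ^+ 2 + 1) <= n%:R by near: n; exact: nbhs_infty_ger.
apply: le_trans (ler_norm A) _; rewrite -sqrtr_sqr; apply: ler_wsqrtr.
have := B_var_approx R n5; rewrite ler_distl => /andP[+ _].
by rewrite -natr1; lra.
Unshelve. all: by end_near. Qed.

Theorem theorem1p2 (R : realType) :
  [/\ asymp_normal_llt (D_coef R) (B_mean R) (B_var R),
      asymp_normal_clt (D_coef R) (B_mean R) (B_var R),
      asymp_equiv (B_mean R) (fun n => n%:R / 2)
    & asymp_equiv (B_var R) (fun n => n%:R / 12)].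
Proof.
have mass : \forall n \near \oo, \sum_(k < n.+1) prob (D_coef R) n k%:Z = 1.
  by exists 1%N => // n; exact: sum_prob_D_coef.
have dom : \forall n \near \oo, forall x : R, `|peak_scale R n *
     prob (D_coef R) n (Num.floor (B_mean R n + x * Num.sqrt (B_var R n)))| <=
  expR 2 * expR (- x ^+ 2 / (2 * 4 ^+ 2)).
  by exists 11%N => // n n11 x; exact: peak_dominated.
have loc := @peak_locally_uniform R.
have s_oo := @sqrt_B_var_cvgy R.
split.
- by apply: (@profile_llt R _ _ _ (peak_scale R) (expR 2) 4).
- by apply: (@profile_clt R _ _ _ (peak_scale R) (expR 2) 4).
- apply: (@asymp_equiv_bounded _ _ 2 1) => //; exists 1%N => // n n1.
  by rewrite B_meanE// -natr1 ler_distl; apply/andP; split; lra.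
- apply: (@asymp_equiv_bounded _ _ 12 1) => //; exists 5%N => // n n5.
  have := B_var_approx R n5; rewrite !ler_distl -natr1 => /andP[a b].
  by apply/andP; split; lra.
Qed.
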